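(* Let $1\le p\le 2$ and let $G$ be a graph of order $n$, size $m$ and spectral radius $\mu$. Then $$\|G\|_{S_p}^p\le \mu^p+(n-1)^{1-p/2}\left(2m-\mu^2\right)^{p/2}.$$
   Context: Graphs are finite, simple and undirected; the order of a graph is its number of vertices, its size is its number of edges, and its spectral radius is the largest eigenvalue of its adjacency matrix. For a graph $G$ of order $n$ with adjacency matrix $A$, let $\sigma_1(G)\ge\cdots\ge\sigma_n(G)$ be the singular values of $A$ (the absolute values of its eigenvalues), and for real $p\ge1$ let $\|G\|_{S_p}=\left(\sigma_1^p(G)+\cdots+\sigma_n^p(G)\right)^{1/p}$ be the Schatten $p$-norm. *)

(* Defs.v *)
From HB Require Import structures.
From mathcomp Require Import all_boot all_order all_algebra.
From mathcomp Require Import polyrcf.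
From mathcomp Require Import reals exp.

Set Implicit Arguments.
Unset Strict Implicit.
Unset Printing Implicit Defensive.

Import Order.TTheory GRing.Theory Num.Theory.

Local Open Scope ring_scope.

Record sgraph := SGraph {
  vertex :> finType;
  adj : rel vertex;
  adj_sym : symmetric adj;
  adj_irrefl : irreflexive adj
}.

Definition edges (G : sgraph) : {set {set G}} :=
  [set [set xy.1; xy.2] | xy : G * G & adj xy.1 xy.2].

Definition graph_order (G : sgraph) : nat := #|G|.

Definition graph_size (G : sgraph) : nat := #|edges G|.

Definition adjacency (R : realType) (G : sgraph) : 'M[R]_(graph_order G) :=
  \matrix_(i, j) (adj (enum_val i) (enum_val j))%:R.

(* The eigenvalues in R of a square matrix, in nonincreasing order and with
   algebraic multiplicity: [rootsR] lists the distinct roots of a nonzero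
   polynomial in R, and [mup x] gives the multiplicity of the root x.  When A is
   symmetric its characteristic polynomial splits over R, so that these are
   all n eigenvalues of A. *)
Definition eigenvalues (R : realType) (n : nat) (A : 'M[R]_n) : seq R :=
  sort >=%R
    (flatten [seq nseq (mup x (char_poly A)) x | x <- rootsR (char_poly A)]).

Lemma mem_eigenvalues (R : realType) (n : nat) (A : 'M[R]_n) (x : R) :
  (x \in eigenvalues A) = eigenvalue A x.
Proof.
rewrite /eigenvalues mem_sort eigenvalue_root_char.
have nz : char_poly A != 0 by apply: monic_neq0; apply: char_poly_monic.
have rE y : (y \in rootsR (char_poly A)) = root (char_poly A) y.
  by rewrite -(roots_on_rootsR nz) in_itv.
apply/flattenP/idP.
  by move=> [s /mapP [y yr ->]]; rewrite mem_nseq => /andP [_ /eqP ->]; rewrite -rE.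
move=> rx; exists (nseq (mup x (char_poly A)) x).
  by apply/mapP; exists x => //; rewrite rE.
by rewrite mem_nseq eqxx andbT mup_geq // expr1 dvdp_XsubCl.
Qed.

Lemma perm_eigenvalues (R : realType) (n : nat) (A : 'M[R]_n) (s : seq R) :
  char_poly A = \prod_(x <- s) ('X - x%:P) -> perm_eq (eigenvalues A) s.
Proof.
move=> cA; rewrite /eigenvalues perm_sort.
have nz : char_poly A != 0 by apply: monic_neq0; apply: char_poly_monic.
have ur : uniq (rootsR (char_poly A)) by apply: (sorted_uniq lt_trans ltxx); apply: sorted_roots.
have rE y : (y \in rootsR (char_poly A)) = (y \in s).
  by rewrite -(roots_on_rootsR nz) in_itv /= cA root_prod_XsubC.
apply/allP => x _ /=; apply/eqP.
rewrite count_flatten sumnE !big_map.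
rewrite (eq_bigr (fun y => if y == x then count_mem x s else 0%N)); last first.
  move=> y _; rewrite count_nseq /= cA mu_prod_XsubC.
  by case: eqP => [->|]; rewrite ?mul1n ?mul0n.
case: (boolP (x \in s)) => xs.
  rewrite (bigD1_seq x) ?rE //= eqxx big1 ?addn0 // => y /negbTE ->//.
rewrite (count_memPn xs) big1 // => y _; by case: ifP.
Qed.

(* The default value 0 is reached only for the graph without vertices. *)
Definition spectral_radius (R : realType) (G : sgraph) : R :=
  head 0 (eigenvalues (adjacency R G)).

Definition singular_values (R : realType) (G : sgraph) : seq R :=
  sort >=%R [seq `|x| | x <- eigenvalues (adjacency R G)].

Definition schatten_norm (R : realType) (p : R) (G : sgraph) : R :=
  (\sum_(s <- singular_values R G) s `^ p) `^ p^-1.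

(* Main.v *)
(* The adjacency matrix is real symmetric, so its n eigenvalues are real, sum to
   its trace 0 and have squares summing to tr A^2 = 2m. Vanishing of the sum
   makes the largest eigenvalue mu nonnegative, so it contributes exactly mu^p;
   the other n - 1 eigenvalues have squares summing to 2m - mu^2, and concavity
   of t |-> t^(p/2) bounds the sum of their p-th absolute powers. *)
Require Import Defs.
From HB Require Import structures.
From mathcomp Require Import all_boot all_order all_algebra.
From mathcomp Require Import polyrcf complex.
From mathcomp Require Import lra.
From mathcomp Require Import reals exp.

Set Implicit Arguments.
Unset Strict Implicit.
Unset Printing Implicit Defensive.

Import Order.TTheory GRing.Theory Num.Theory.

Local Open Scope ring_scope.

Lemma char_poly_invmx_conj (F : fieldType) (n : nat) (P B : 'M[F]_n) :
  P \in unitmx -> char_poly (invmx P *m B *m P) = char_poly B.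
Proof.
move=> Pu; rewrite /char_poly.
have VP : map_mx polyC (invmx P) *m map_mx polyC P = 1%:M.
  by rewrite -map_mxM mulVmx // map_mx1.
have -> : char_poly_mx (invmx P *m B *m P)
    = map_mx polyC (invmx P) *m char_poly_mx B *m map_mx polyC P.
  rewrite /char_poly_mx mulmxBr mulmxBl scalar_mxC -(mulmxA _%:M) VP !map_mxM.
  by rewrite mulmx1.
by rewrite !det_mulmx mulrAC -det_mulmx VP det1 mul1r.
Qed.

(** The spectral theorem is applied over [R[i]], where [A] becomes a real symmetric, hence
    Hermitian, matrix; its diagonal form has real entries. The three identities hold there by
    similarity and descend to [R] because the embedding is injective. *)
Lemma symmetric_real_spectrum (R : realType) (n : nat) (A : 'M[R]_n) :
  A^T = A ->
  exists d : 'I_n -> R,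
    [/\ char_poly A = \prod_i ('X - (d i)%:P),
        \tr A = \sum_i d i & \tr (A *m A) = \sum_i d i ^+ 2].
Proof.
move=> Asym; pose C := map_mx (real_complex R) A : 'M[R[i]]_n.
have Csym : C \is symmetricmx.
  by apply/is_hermitianmxP; rewrite expr0 scale1r map_mx_id // /C map_trmx Asym.
have Creal : C \is a realmx.
  by apply/mxOverP => i j; rewrite mxE complex_real.
have /orthomx_spectralP := symmetric_normalmx Csym Creal.
have /mxOverP dreal :=
  hermitian_spectral_diag_real (realsym_hermsym Csym Creal).
set P := spectralmx C; set e := spectral_diag C => CE.
have Pu : P \in unitmx by apply: spectral_unit.
(* Taking real parts loses nothing, since [dreal] says that the entries of [e] are real. *)
exists (fun i => complex.Re (e 0 i)).
have eE i : real_complex R (complex.Re (e 0 i)) = e 0 i by apply: RRe_real.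
split.
- apply: (map_inj_poly (@complexI R)) => //.
  rewrite map_char_poly -/C CE char_poly_invmx_conj //.
  rewrite char_poly_trig; last first.
    exact: diag_mx_is_trig.
  rewrite rmorph_prod; apply: eq_bigr => i _.
  by rewrite /= rmorphB /= map_polyX map_polyC /= eE !mxE eqxx.
- apply: (@complexI R); rewrite -/(real_complex R _) -trace_map_mx -/C.
  rewrite CE mxtrace_mulC mulmxA mulmxV // mul1mx mxtrace_diag rmorph_sum.
  by apply: eq_bigr => i _; rewrite /= eE.
- apply: (@complexI R); rewrite -trace_map_mx map_mxM -/C.
  rewrite CE -!mulmxA (mulmxA P) mulmxV // mul1mx mxtrace_mulC -!mulmxA.
  rewrite mulmxV // mulmx1 mulmx_diag mxtrace_diag rmorph_sum.
  by apply: eq_bigr => i _; rewrite /= rmorphXn /= eE mxE expr2.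
Qed.

(** Double counting: the fibre of [f] over an edge with ends [a] and [b] consists of [(a, b)] and
    [(b, a)], distinct by irreflexivity. *)
Lemma card_adjacent_pairs (G : sgraph) :
  (#|[set xy : G * G | adj xy.1 xy.2]| = (graph_size G).*2)%N.
Proof.
pose D := [set xy : G * G | adj xy.1 xy.2].
pose f (xy : G * G) : {set G} := [set xy.1; xy.2].
have edgesE : edges G = f @: D.
  by apply/setP=> B; apply/imsetP/imsetP => -[xy xyD ->]; exists xy;
    move: xyD; rewrite // !inE.
rewrite -/D -sum1_card (partition_big f (mem (edges G))) /=; last first.
  by move=> xy xyD; rewrite edgesE imset_f.
rewrite -muln2 -sum_nat_const; apply: eq_bigr => B.
rewrite edgesE => /imsetP [[a b]]; rewrite inE /= => ab ->.
have neq_ab : a != b by apply: contraTneq ab => ->; rewrite adj_irrefl.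
have neq_ba : ((a, b) != (b, a)) = true by rewrite xpair_eqE negb_and neq_ab.
(* The number 2 is put in the form that [cards2] gives to the cardinal of the pair set, so that only
   an equality of sets remains. *)
rewrite sum1_card -[2%N]/(true.+1) -[in RHS]neq_ba.
rewrite -cards2; apply: eq_card => -[x y]; rewrite !inE /f /=.
apply/idP/orP => [|[] /eqP [-> ->]]; last 2 first.
- by rewrite unfold_in !inE /= ab eqxx.
- by rewrite unfold_in !inE /= adj_sym ab setUC eqxx.
rewrite unfold_in !inE /= => /andP [xy /eqP E].
have neq_xy : x != y by apply: contraTneq xy => ->; rewrite adj_irrefl.
have := set21 x y; have := set22 x y; rewrite E !inE.
move=> /orP [] /eqP yE /orP [] /eqP xE; subst x y;
  rewrite ?eqxx in neq_xy *; by [|left|right].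
Qed.

Lemma tr_adjacency (R : realType) (G : sgraph) :
  (adjacency R G)^T = adjacency R G.
Proof. by apply/matrixP => i j; rewrite !mxE adj_sym. Qed.

Lemma mxtrace_adjacency (R : realType) (G : sgraph) :
  \tr (adjacency R G) = 0.
Proof. by rewrite /mxtrace big1 // => i _; rewrite mxE adj_irrefl. Qed.

(** With symmetric 0/1 entries, the trace of the square counts ordered adjacent pairs. *)
Lemma mxtrace_adjacency_sqr (R : realType) (G : sgraph) :
  \tr (adjacency R G *m adjacency R G) = 2 * (graph_size G)%:R.
Proof.
rewrite -natrM mul2n -card_adjacent_pairs -sum1dep_card natr_sum big_mkcond /=.
rewrite -(pair_bigA _ (fun x y => if adj x y then 1%:R else 0 : R)) /=.
rewrite (reindex _ (onW_bij _ (@enum_val_bij G))) /=; apply: eq_bigr => i _.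
rewrite mxE (reindex _ (onW_bij _ (@enum_val_bij G))) /=; apply: eq_bigr => j _.
rewrite !mxE [adj (enum_val j) _]adj_sym.
by case: ifP => _; rewrite ?mulr1 ?mulr0.
Qed.

Lemma adjacency_eigenvalues (R : realType) (G : sgraph) :
  [/\ size (eigenvalues (adjacency R G)) = graph_order G,
      \sum_(x <- eigenvalues (adjacency R G)) x = 0 &
      \sum_(x <- eigenvalues (adjacency R G)) x ^+ 2 = 2 * (graph_size G)%:R].
Proof.
have [d [cE t1 t2]] := symmetric_real_spectrum (tr_adjacency R G).
have pE : perm_eq (eigenvalues (adjacency R G)) 
    [seq d i | i <- index_enum 'I_(graph_order G)].
  by apply: perm_eigenvalues; rewrite big_map.
split.
- by rewrite (perm_size pE) size_map -[index_enum _]enumT size_enum_ord.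
- by rewrite (perm_big _ pE) big_map /= -t1 mxtrace_adjacency.
- by rewrite (perm_big _ pE) big_map /= -t2 mxtrace_adjacency_sqr.
Qed.

Lemma spectral_radius_ge0 (R : realType) (G : sgraph) :
  0 <= spectral_radius R G.
Proof.
have [_ s0 _] := adjacency_eigenvalues R G; rewrite /spectral_radius.
have: sorted >=%R (eigenvalues (adjacency R G)).
  by apply: sort_sorted => x y; apply: le_total.
(* An empty list gives the default 0. Otherwise the head is the maximum, and if it were negative the
   whole sum would be. *)
case: (eigenvalues _) s0 => [|x s] //= s0.
rewrite (path_sortedE (rev_trans le_trans)) => /andP [/allP xmax _].
rewrite leNgt; apply/negP => x_lt0.
suff: \sum_(y <- x :: s) y < 0 by rewrite s0 ltxx.
rewrite big_cons big_seq.
have: \sum_(y <- s | y \in s) y <= 0.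
  by apply: sumr_le0 => y /xmax /= yx; apply: le_trans yx (ltW x_lt0).
lra.
Qed.

(* Young's inequality with exponent q^-1, one of the two factors being 1. *)
Lemma powR_le_tangent (R : realType) (q t : R) :
  0 < q <= 1 -> 0 <= t -> t `^ q <= q * t + (1 - q).
Proof.
(* At [q = 1] the conjugate exponent [(1 - q)^-1] degenerates, so this case is separate. *)
move=> /andP [q_gt0]; rewrite le_eqVlt => /predU1P [->|q_lt1] t_ge0.
  by rewrite powRr1 // mul1r subrr addr0.
have := @conjugate_powR R (t `^ q) 1 q^-1 (1 - q)^-1.
rewrite powR1 mulr1 -powRrM mulfV ?gt_eqF // powRr1 // !invrK mul1r mulrC.
by rewrite (addrC q) subrK; apply; rewrite ?invr_gt0 ?subr_gt0 ?powR_ge0.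
Qed.

(** Jensen's inequality for the power [q]: rescale the terms to mean 1, then add up the tangent
    bounds at 1. *)
Lemma sum_powR_le (R : realType) (q : R) (s : seq R) :
  0 < q <= 1 -> all (>= 0) s ->
  \sum_(y <- s) y `^ q <= (size s)%:R `^ (1 - q) * (\sum_(y <- s) y) `^ q.
Proof.
move=> q01 /allP s_ge0; have /andP [q_gt0 _] := q01.
set S := \sum_(y <- s) y; have S_ge0 : 0 <= S by rewrite /S big_seq sumr_ge0.
move: S_ge0; rewrite le_eqVlt => /predU1P [S0|S_gt0].
  rewrite -S0 powR0 ?gt_eqF // mulr0 big_seq big1 // => y ys.
  have /eqP := esym S0; rewrite /S big_seq psumr_eq0 // => /allP /(_ _ ys).
  by rewrite ys => /eqP ->; rewrite powR0 ?gt_eqF.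
set N : R := (size s)%:R.
have N_gt0 : 0 < N.
  rewrite ltr0n; move: S_gt0.
  by rewrite /S; case: (s) => //; rewrite big_nil ltxx.
(* Multiplying by this factor replaces each [y] by [y * (N / S)] and turns the right side into
   [N]. *)
have c_gt0 : 0 < (N / S) `^ q by rewrite powR_gt0 // divr_gt0.
rewrite -(ler_pM2r c_gt0) mulr_suml.
have -> : N `^ (1 - q) * S `^ q * (N / S) `^ q = N.
  rewrite -mulrA -powRM ?ltW ?divr_gt0 // mulrCA divff ?gt_eqF // mulr1.
  by rewrite -powRD ?subrK ?powRr1 ?(ltW N_gt0) // gt_eqF ?implybT.
apply: (@le_trans _ _ (\sum_(y <- s) (q * (y * (N / S)) + (1 - q)))).
  rewrite big_seq [leRHS]big_seq; apply: ler_sum => y ys.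
  have y_ge0 := s_ge0 _ ys.
  rewrite -powRM ?(ltW (divr_gt0 _ _)) //.
  by apply: powR_le_tangent; rewrite // mulr_ge0 // ltW ?divr_gt0.
(* The tangent bounds add up to [q * N + (1 - q) * N], that is [N]. *)
rewrite big_split /= -mulr_sumr -mulr_suml -/S.
rewrite (mulrCA S) mulfV ?gt_eqF // mulr1.
rewrite big_const_seq count_predT iter_addr_0 -mulr_natr -/N; lra.
Qed.

Theorem proposition7 (R : realType) (p : R) (hp1 : 1 <= p) (hp2 : p <= 2)
    (G : sgraph) (n m : nat) (mu : R)
    (hn : graph_order G = n) (hm : graph_size G = m)
    (hmu : spectral_radius R G = mu) :
  schatten_norm p G `^ p
    <= mu `^ p + (n%:R - 1) `^ (1 - p / 2) * (2 * m%:R - mu ^+ 2) `^ (p / 2).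
Proof.
have p_neq0 : p != 0 by lra.
rewrite /schatten_norm -powRrM mulVf // powRr1; last first.
  by apply: sumr_ge0 => x _; apply: powR_ge0.
rewrite /singular_values (perm_big _ (permEl (perm_sort _ _))) big_map /=.
have [] := adjacency_eigenvalues R G.
have := spectral_radius_ge0 R G.
rewrite hmu hm; move: hmu; rewrite /spectral_radius.
case: (eigenvalues _) => [|x s] /= <-.
  (* Graph without vertices: the left side is 0, and [powR] is nonnegative even at the base
     [n%:R - 1], here -1. *)
  by rewrite !big_nil => *; rewrite addr_ge0 ?mulr_ge0 ?powR_ge0.
move=> x_ge0 sz _; rewrite !big_cons ger0_norm // => sum_sqr; rewrite lerD2l.
have -> : n%:R - 1 = (size [seq y ^+ 2 | y <- s])%:R :> R.
  by rewrite size_map -hn -sz -addn1 natrD addrK.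
have -> : 2 * m%:R - x ^+ 2 = \sum_(y <- [seq y ^+ 2 | y <- s]) y.
  by rewrite big_map -sum_sqr addrC addKr.
(* Jensen with [q = p / 2] on the squares of the other eigenvalues, each [|y|] to the power [p]
   being [y ^+ 2] to the power [p / 2]. *)
apply: le_trans (sum_powR_le _ _); last 2 first.
- by apply/andP; split; lra.
- by apply/allP => _ /mapP [y _ ->]; apply: sqr_ge0.
rewrite big_map; apply: ler_sum => y _.
rewrite -(real_normK (num_real y)) -powR_mulrn // -powRrM.
by rewrite mulrC divfK // pnatr_eq0.
Qed.
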